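(* Let $G\subset\mathrm{GL}(V)$ be a duality group, $\dim_{\mathbb C} V=n$, with degrees $d_1\ge\dots\ge d_n$. Let $(g,\zeta,q)$ be an admissible triplet of $G$, $z=(z_1,\ldots,z_n)$ a $(g,\zeta)$-graded coordinate system of $V$, and $x=(x_1,\ldots,x_n)$ a set of good basic invariants of $G$ with respect to $(g,\zeta,q)$ which is compatible with $z$ at $q$. Let $(\mathcal G_1,\ldots,\mathcal G_n)$ be the potential vector field of $G$ defined by these data. Let $\delta>1$ be a divisor of $d_1$, $E=V(g^{d_1/\delta},\zeta^{d_1/\delta})$ (the $\zeta^{d_1/\delta}$-eigenspace of $g^{d_1/\delta}$), and $G_\delta=\pi_E(N_E)\subset \mathrm{GL}(E)$. Then: (1) $\phi_E(\mathcal G_\gamma)=0$ for $\gamma\in\mathfrak i^c(\delta)$. (2) $\phi_E(\mathcal G_\gamma)$ $(\gamma\in\mathfrak i(\delta))$ form a potential vector field of $G_\delta$.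
   Context: Reflection groups. A reflection on a complex vector space $V$ is a linear transformation of finite order which fixes a hyperplane pointwise (and is not the identity). A finite complex reflection group is a finite subgroup $G\subset\mathrm{GL}(V)$ generated by reflections. $S[V]$ denotes the ring of polynomial functions on $V$. The ring of $G$-invariants $S[V]^G$ is generated by $n=\dim V$ algebraically independent homogeneous polynomials $x_1,\ldots,x_n$; such a set is called a set of basic invariants, and the degrees of $G$ are $d_\alpha=\deg x_\alpha$, ordered so that $d_1\ge\dots\ge d_n$. The codegrees $d_1^*(=0)\le\dots\le d_n^*$ of $G$ are the integers such that the free $S[V]^G$-module of $G$-invariant polynomial derivations of $S[V]$ has a homogeneous basis whose elements have coefficients of polynomial degrees $d_1^*+1,\ldots,d_n^*+1$. A duality group is an irreducible finite complex reflection group satisfying $d_\alpha+d_\alpha^*=d_1$ for $1\le\alpha\le n$. Notation. For a positive integer $d$: $\mathfrak i(d)=\{\alpha\in\{1,\ldots,n\}\mid d\text{ divides }d_\alpha\}$, $\mathfrak i^c(d)=\{1,\ldots,n\}\setminus\mathfrak i(d)$. For $h\in \mathrm{GL}(V)$ and $\xi\in\mathbb C$, $V(h,\xi)$ is the $\xi$-eigenspace of $h$ in $V$. Regularity and admissible triplets. A vector $q\in V$ is regular if it lies on no reflection hyperplane of $G$. An element $g\in G$ is $\zeta$-regular if $V(g,\zeta)$ contains a regular vector. An admissible triplet of $G$ is a triple $(g,\zeta,q)$ where $\zeta$ is a primitive $d_1$-th root of unity ($d_1$ the largest degree), $g\in G$ is $\zeta$-regular, and $q$ is a regular vector with $gq=\zeta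 q$. (Admissible triplets exist for every duality group.) Graded coordinates. A linear coordinate system $z=(z_1,\ldots,z_n)$ of $V$ is $(g,\zeta)$-graded if $g^*z_\alpha=\zeta^{d_\alpha-1}z_\alpha$ for $1\le\alpha\le n$, where $g^*f=f\circ g^{-1}$ (i.e. the basis $q_1,\ldots,q_n$ of $V$ dual to $z$ satisfies $gq_\alpha=\zeta^{1-d_\alpha}q_\alpha$). Compatibility. A set of basic invariants $x=(x_1,\ldots,x_n)$ is compatible at $q$ with a $(g,\zeta)$-graded coordinate system $z$ if $\frac{\partial x_\alpha}{\partial z_\beta}(q)=1$ when $\alpha=\beta$ and $0$ when $\alpha\ne\beta$ $(1\le\alpha,\beta\le n)$. Good basic invariants. Put $I_\alpha^{(0)}=\{(a_1,\ldots,a_n)\in\mathbb Z_{\ge0}^n\mid a_1d_1+\cdots+a_nd_n=d_\alpha,\ a_1+\cdots+a_n\ge2\}$. A set of basic invariants $x$ is good with respect to $(g,\zeta,q)$ if $$\frac{\partial^{a_1+\cdots+a_n}x_\alpha}{\partial z_1^{a_1}\cdots\partial z_n^{a_n}}(q)=0\qquad(1\le\alpha\le n,\ (a_1,\ldots,a_n)\in I_\alpha^{(0)}),$$ where $z$ is a $(g,\zeta)$-graded coordinate system of $V$ (the condition does not depend on the choice of $z$). Potential vector field. Let $G$ be a duality group with an admissible triplet $(g,\zeta,q)$, a $(g,\zeta)$-graded coordinate system $z$, and a set of good basic invariants $x$ with respect to $(g,\zeta,q)$ which is compatible with $z$ at $q$. Put $I_\gamma^{(1)}=\{(a_1,\ldots,a_n)\in\mathbb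 Z_{\ge0}^n\mid a_1d_1+\cdots+a_nd_n=d_\gamma+d_1,\ a_1+\cdots+a_n\ge2\}$. The potential vector field of $G$ (defined by these data) is the $n$-tuple $(\mathcal G_1,\ldots,\mathcal G_n)$ of $G$-invariant polynomials $$\mathcal G_\gamma=\frac{z_1(q)}{d_\gamma-1}\sum_{(a_1,\ldots,a_n)\in I_\gamma^{(1)}}\frac{\partial^{a_1+\cdots+a_n}x_\gamma}{\partial z_1^{a_1}\cdots\partial z_n^{a_n}}(q)\cdot\frac{x_1^{a_1}\cdots x_n^{a_n}}{a_1!\cdots a_n!}\qquad(1\le\gamma\le n).$$ A potential vector field of a duality group is a tuple obtained in this way from some choice of such data. Reflection subquotient. For a subspace $E\subset V$, $N_E=\{s\in G\mid s(E)\subset E\}$, $\pi_E:N_E\to\mathrm{GL}(E)$ is the restriction map $s\mapsto s|_E$, and $\phi_E:S[V]\to S[E]$ is the surjective ring homomorphism given by restricting polynomial functions to $E$. For $E=V(g^{d_1/\delta},\zeta^{d_1/\delta})$ as in the claim, it is known that $G_\delta=\pi_E(N_E)$ is a finite complex reflection group on $E$ with degrees $d_\alpha$ $(\alpha\in\mathfrak i(\delta))$, so its highest degree is $d_1$; that the $\phi_E(x_\alpha)$ $(\alpha\in\mathfrak i(\delta))$ form a set of basic invariants of $G_\delta$ and $\phi_E(x_\alpha)=0$ for $\alpha\in\mathfrak i^c(\delta)$; that $q\in E$, $g\in N_E$ and $(\pi_E(g),\zeta,q)$ is an admissible triplet of $G_\delta$; and that $G_\delta$ is again a duality group. All notions for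 $G_\delta$ are those above applied to $G_\delta$ acting on $E$, with coordinates, invariants and components of the potential vector field indexed by $\mathfrak i(\delta)$ (in increasing order) and with degrees $d_\alpha$ $(\alpha\in\mathfrak i(\delta))$. *)

(* Defs.v *)
From mathcomp Require Import all_boot all_order all_algebra.
From mathcomp Require Import finmap mpoly complex reals.

Set Implicit Arguments.
Unset Strict Implicit.
Unset Printing Implicit Defensive.

Import GRing.Theory Num.Theory.

Local Open Scope ring_scope.

Section PolynomialFunctions.
Variable C : numClosedFieldType.
Implicit Types U V : vectType C.

(* S[V].  As C is infinite, polynomial functions on V are the same thing as
   polynomials in the coordinates relative to the fixed basis vbasis {:V}. *)
Definition Spoly V := {mpoly C[\dim {:V}]}.

Definition coords V n (b : n.-tuple V) (v : V) : n.-tuple C :=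
  [tuple coord b i v | i < n].

Definition peval V (p : Spoly V) (v : V) : C :=
  p.@[tnth (coords (vbasis {:V}) v)].

(* The polynomial function p \o f on U (see peval_pullback). *)
Definition pullback U V (f : 'Hom(U, V)) (p : Spoly V) : Spoly U :=
  p \mPo [tuple \sum_j coord (vbasis {:V}) i (f (tnth (vbasis {:U}) j)) *: 'X_j
         | i < \dim {:V}].

(* A linear coordinate system z_1, ..., z_n of V is given by its dual basis b:
   z_i = coord b i.  [in_coords b p] is p as a polynomial in z_1, ..., z_n
   (see meval_in_coords). *)
Definition in_coords V n (b : n.-tuple V) (p : Spoly V) : {mpoly C[n]} :=
  p \mPo [tuple \sum_j coord (vbasis {:V}) i (tnth b j) *: 'X_j
         | i < \dim {:V}].

Definition partial V n (b : n.-tuple V) (a : 'X_{1..n}) (p : Spoly V) (v : V)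
    : C :=
  ((in_coords b p)^`M[a]).@[tnth (coords b v)].

Lemma peval_pullback U V (f : 'Hom(U, V)) (p : Spoly V) (u : U) :
  peval (pullback f p) u = peval p (f u).
Proof.
rewrite /peval /pullback comp_mpoly_meval; apply: meval_eq => i.
rewrite !tnth_mktuple rmorph_sum /=.
rewrite {2}(coord_vbasis (memvf u)) !linear_sum /=; apply: eq_bigr => j _.
by rewrite mevalZ mevalXU !linearZ /= tnth_mktuple mulrC (tnth_nth 0).
Qed.

Lemma meval_in_coords V n (b : n.-tuple V) (p : Spoly V) (v : V) :
  basis_of {:V} b -> (in_coords b p).@[tnth (coords b v)] = peval p v.
Proof.
move=> bV; rewrite /peval /in_coords comp_mpoly_meval; apply: meval_eq => i.
rewrite !tnth_mktuple rmorph_sum /=.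
rewrite {2}(coord_basis bV (memvf v)) !linear_sum /=; apply: eq_bigr => j _.
by rewrite mevalZ mevalXU !linearZ /= tnth_mktuple mulrC (tnth_nth 0).
Qed.

End PolynomialFunctions.

Section ReflectionGroups.
Variables (C : numClosedFieldType) (V : vectType C).
Implicit Types (G : {fset 'End(V)}) (s : 'End(V)) (n : nat).

Definition lfun_pow s k : 'End(V) := iter k (comp_lfun s) \1%VF.

Definition finite_linear_group G :=
  [/\ \1%VF \in G,
      forall s t, s \in G -> t \in G -> (s \o t)%VF \in G
    & forall s, s \in G -> exists2 t, t \in G & (t \o s)%VF = \1%VF].

Definition is_reflection s :=
  [/\ exists k, (0 < k)%N /\ lfun_pow s k = \1%VF,
      s != \1%VF
    & exists H : {vspace V}, (\dim H).+1 = \dim {:V} /\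
        {in H, forall v, s v = v}].

Definition reflection_group G :=
  finite_linear_group G /\
  forall s, s \in G -> exists ts : seq 'End(V),
    (forall t, t \in ts -> t \in G /\ is_reflection t) /\
    s = \big[@comp_lfun C V V V / \1%VF]_(t <- ts) t.

Definition irreducible_group G :=
  (0 < \dim {:V})%N /\
  forall W : {vspace V}, (forall s, s \in G -> (s @: W <= W)%VS) ->
    W = 0%VS \/ W = {:V}%VS.

Definition invariant G (p : Spoly V) := forall s, s \in G -> pullback s p = p.

Definition basic_invariants G n (d : n.-tuple nat) (x : n.-tuple (Spoly V)) :=
  [/\ n = \dim {:V},
      sorted geq d,
      forall i, tnth x i \is (tnth d i).-homog /\ invariant G (tnth x i),
      forall P : {mpoly C[n]}, P \mPo x = 0 -> P = 0
    & forall p, invariant G p -> exists P : {mpoly C[n]}, p = P \mPo x].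

Definition degrees G n (d : n.-tuple nat) := exists x, basic_invariants G d x.

Definition is_derivation (D : Spoly V -> Spoly V) :=
  linear D /\ forall p r, D (p * r) = D p * r + p * D r.

Definition invariant_derivation G (D : Spoly V -> Spoly V) :=
  is_derivation D /\
  forall s p, s \in G -> D (pullback s p) = pullback s (D p).

(* The coefficients of a derivation D are the D 'X_j. *)
Definition codegrees G n (e : n.-tuple nat) :=
  n = \dim {:V} /\ sorted leq e /\
  exists D : 'I_n -> Spoly V -> Spoly V,
  [/\ forall i, invariant_derivation G (D i),
      forall i j, D i 'X_j \is (tnth e i).+1.-homog,
      forall f : 'I_n -> Spoly V, (forall i, invariant G (f i)) ->
        (forall p, \sum_i f i * D i p = 0) -> forall i, f i = 0
    & forall D', invariant_derivation G D' ->
        exists f : 'I_n -> Spoly V, (forall i, invariant G (f i)) /\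
          forall p, D' p = \sum_i f i * D i p].

(* The largest degree d_1, as sequences of degrees are nonincreasing. *)
Definition top_degree n (d : n.-tuple nat) : nat := head 0%N d.

Definition duality_group G n (d : n.-tuple nat) :=
  [/\ reflection_group G, irreducible_group G, degrees G d
    & exists2 e : n.-tuple nat, codegrees G e &
        forall i, (tnth d i + tnth e i)%N = top_degree d].

Definition regular_vector G (q : V) :=
  forall s, s \in G -> is_reflection s -> q \notin fixedSpace s.

Definition regular_element G s (zeta : C) :=
  exists2 q, q \in passmx.leigenspace s zeta & regular_vector G q.

Definition admissible_triplet G n (d : n.-tuple nat) (g : 'End(V)) (zeta : C)
    (q : V) :=
  [/\ (top_degree d).-primitive_root zeta,
      g \in G /\ regular_element G g zeta,
      regular_vector G q
    & g q = zeta *: q].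

Definition graded_coordinates n (d : n.-tuple nat) (g : 'End(V)) (zeta : C)
    (b : n.-tuple V) :=
  basis_of {:V} b /\
  forall i v, coord b i ((g^-1)%VF v) = zeta ^+ (tnth d i).-1 * coord b i v.

Definition compatible n (b : n.-tuple V) (x : n.-tuple (Spoly V)) (q : V) :=
  forall i j, partial b U_(j)%MM (tnth x i) q = (i == j)%:R.

Definition wdeg n (d : n.-tuple nat) (a : 'X_{1..n}) : nat :=
  (\sum_i a i * tnth d i)%N.

Definition good_at n (d : n.-tuple nat) (b : n.-tuple V)
    (x : n.-tuple (Spoly V)) (q : V) :=
  forall i (a : 'X_{1..n}), wdeg d a = tnth d i -> (2 <= mdeg a)%N ->
    partial b a (tnth x i) q = 0.

(* The degrees being positive, wdeg d a = d_c + d_1 forces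
   mdeg a <= d_c + d_1, so the bound on a excludes no multi-index. *)
Definition pvf_component n (d : n.-tuple nat) (b : n.-tuple V)
    (x : n.-tuple (Spoly V)) (q : V) (c : 'I_n) : Spoly V :=
  let N := (tnth d c + top_degree d)%N in
  (head 0 (coords b q) / ((tnth d c)%:R - 1)) *:
  \sum_(a : 'X_{1..n < N.+1} | (wdeg d a == N) && (2 <= mdeg a)%N)
    (partial b a (tnth x c) q / (\prod_i (a i)`!)%N%:R) *:
    \prod_i tnth x i ^+ a i.

Definition pvf n d (b : n.-tuple V) x q : n.-tuple (Spoly V) :=
  [tuple pvf_component d b x q c | c < n].

Definition pvf_data G n (d : n.-tuple nat) g zeta q (b : n.-tuple V) x :=
  [/\ admissible_triplet G d g zeta q,
      graded_coordinates d g zeta b,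
      basic_invariants G d x,
      good_at d b x q
    & compatible b x q].

(* That G is a duality group with degrees d is a standing assumption on G, not
   part of the data from which a potential vector field is built. *)
Definition is_potential_vector_field G n (d : n.-tuple nat)
    (P : n.-tuple (Spoly V)) :=
  exists g zeta q b x, pvf_data G d g zeta q b x /\ P = pvf d b x q.

End ReflectionGroups.

Section Subquotient.
Variables (C : numClosedFieldType) (V : vectType C) (E : {vspace V}).

Definition stabilizer (G : {fset 'End(V)}) : {fset 'End(V)} :=
  [fset s in G | (s @: E <= E)%VS]%fset.

Definition inclusion : 'Hom(subvs_of E, V) := linfun vsval.

(* For s with s(E) contained in E this is the restriction of s to E. *)
Definition restrict_end (s : 'End(V)) : 'End(subvs_of E) :=
  linfun (fun u => vsproj E (s (vsval u))).

Definition subquotient (G : {fset 'End(V)}) : {fset 'End(subvs_of E)} :=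
  [fset restrict_end s | s in stabilizer G]%fset.

Definition restrict_poly (p : Spoly V) : Spoly (subvs_of E) :=
  pullback inclusion p.

End Subquotient.

Definition divisible_indices n (d : n.-tuple nat) (k : nat) : {set 'I_n} :=
  [set i | k %| tnth d i]%N.

(* enum_val lists the elements of a subset of 'I_n in increasing order. *)
Definition subtuple n (I : {set 'I_n}) (T : Type) (t : n.-tuple T)
    : #|I|.-tuple T :=
  [tuple tnth t (enum_val i) | i < #|I|].

(* Main.v *)
Require Import Defs.
From mathcomp Require Import all_boot all_order all_algebra.
From mathcomp Require Import finmap mpoly complex reals.

(* In graded coordinates, E is the coordinate subspace of the indices
   I = i(delta), and x_j vanishes on E for j outside I by homogeneity.
   Hence every monomial of weight d_c + d_1 restricts to 0 on E unless it only
   involves indices in I, and then delta divides its weight: this gives (1), and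
   reduces (2) to showing that the restrictions y_i of x_i to E, i in I, are
   basic invariants of G_delta, the remaining data restricting verbatim.
   Compatibility makes everything elementary: as the Jacobian of x at q is the
   identity, q has trivial stabilizer in G and the y_i are algebraically
   independent.  To see that an invariant p of G_delta is a polynomial in y, let
   chi be a polynomial with chi(q) = 1 vanishing on sE for s outside N_E and at
   sq for 1 <> s in N_E.  Averaging chi * p^j over G gives elements of S[V]^G
   whose restrictions to E are theta * p^j with theta(q) = 1.  So
   theta * p^j is in C[y] for all j, and C[y] is completely integrally
   closed. *)

Set Implicit Arguments.
Unset Strict Implicit.
Unset Printing Implicit Defensive.

Import Order.TTheory GRing.Theory Num.Theory.

Local Open Scope ring_scope.

(** * Polynomials in several variables: derivatives, evaluation and algebraic independence *)

Lemma mpoly_alg_ind n (R : comNzRingType) (Q : {mpoly R[n]} -> Prop) :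
  (forall c, Q c%:MP) -> (forall i, Q 'X_i) ->
  (forall p r, Q p -> Q r -> Q (p + r)) ->
  (forall p r, Q p -> Q r -> Q (p * r)) ->
  forall p, Q p.
Proof.
move=> QC QX QD QM p; rewrite [p]mpolyE.
elim/big_ind: _ => [||m _]; [by rewrite -(mpolyC0 n R) | exact: QD |].
rewrite -mul_mpolyC; apply: (QM) => //; rewrite mpolyXE_id.
elim/big_ind: _ => [||i _]; [by rewrite -(mpolyC1 n R) | exact: (QM) |].
elim: (m i) => [|k IHk]; first by rewrite expr0 -(mpolyC1 n R).
by rewrite exprS; apply: QM.
Qed.

Lemma mnm_subUU n (i : 'I_n) : (U_(i) - U_(i))%MM = 0%MM.
Proof. by apply/mnmP => j; rewrite mnmBE mnm0E subnn. Qed.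

Lemma mnm_lepU n (i : 'I_n) (m : 'X_{1..n}) : (U_(i) <= m)%MM = (m i != 0%N).
Proof.
apply/mnm_lepP/idP => [/(_ i)|mi j]; rewrite mnm1E ?eqxx -?lt0n //.
by case: eqP => // <-; rewrite lt0n.
Qed.

Lemma mderiv_comp n k (R : comNzRingType) (p : {mpoly R[n]})
    (y : n.-tuple {mpoly R[k]}) (j : 'I_k) :
  (p \mPo y)^`M(j) = \sum_i (p^`M(i) \mPo y) * (tnth y i)^`M(j).
Proof.
elim/mpoly_alg_ind: p => [c|i|p r IHp IHr|p r IHp IHr].
- rewrite comp_mpolyC mderivC big1 // => i _.
  by rewrite mderivC comp_mpoly0 mul0r.
- rewrite comp_mpolyXU -tnth_nth (bigD1 i) //= mderivX mnm1E eqxx.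
  rewrite mnm_subUU mpolyX0 scale1r comp_mpoly1 mul1r big1 ?addr0 // => l li.
  by rewrite mderivX mnm1E eq_sym (negbTE li) scale0r comp_mpoly0 mul0r.
- rewrite comp_mpolyD mderivD IHp IHr -big_split; apply: eq_bigr => i _ /=.
  by rewrite mderivD comp_mpolyD mulrDl.
- rewrite rmorphM mderivM IHp IHr mulr_suml mulr_sumr -big_split.
  apply: eq_bigr => i _ /=; rewrite mderivM comp_mpolyD !rmorphM mulrDl.
  by rewrite mulrAC [X in _ + X]mulrA.
Qed.

(** If [m i] is nonzero, the coefficient of [p] at [m], multiplied by the natural number [m i], is a
    coefficient of the [i]-th derivative; characteristic zero then kills it. *)
Lemma mderiv_eq0 n (R : numDomainType) (p : {mpoly R[n]}) :
  (forall i, p^`M(i) = 0) -> p = (p@_0)%:MP.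
Proof.
move=> dp0; apply/mpolyP => m; rewrite mcoeffC.
have [<-|m0] := eqVneq; first by rewrite mulr1.
have /existsP [i mi] : [exists i, m i != 0%N].
  rewrite -negb_forall; apply: contra m0 => /forallP m0.
  by apply/eqP/mnmP => i; rewrite mnm0E (eqP (m0 i)).
have := congr1 (mcoeff (m - U_(i))) (dp0 i).
rewrite mcoeff_mderiv mcoeff0 submK; last by rewrite mnm_lepU.
by move/eqP; rewrite mulrn_eq0 /= => /eqP ->; rewrite mulr0.
Qed.

(** Induction on [msize], which drops strictly when a nonzero derivative is taken. *)
Lemma mderiv_ind n (R : numDomainType) (Q : {mpoly R[n]} -> Prop) :
  (forall c, Q c%:MP) -> (forall p, (forall i, Q p^`M(i)) -> Q p) ->
  forall p, Q p.
Proof.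
move=> QC QD p; move: {2}(msize p) (leqnn (msize p)) => k.
elim: k p => [|k IHk] p; first by
  rewrite leqn0 mmeasure_poly_eq0 => /eqP ->; rewrite -(mpolyC0 n R).
move=> pk; apply: QD => i; apply: IHk; rewrite leqNgt.
apply/negP => dpk; have dp0 : p^`M(i) != 0.
  by apply: contraTneq dpk => ->; rewrite msize0.
have := mlead_supp dp0; rewrite mcoeff_msupp mcoeff_mderiv.
rewrite mulrn_eq0 /= -mcoeff_msupp => /msize_mdeg_lt.
rewrite mdegD mdeg1 addn1 mlead_deg // => /leq_trans /(_ pk).
by rewrite ltnNge dpk.
Qed.

(** The natural numbers are distinct in [R], so there are [size p] distinct roots, more than a
    nonzero [p] can have. *)
Lemma poly_all_roots (R : numDomainType) (p : {poly R}) :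
  (forall t, p.[t] = 0) -> p = 0.
Proof.
move=> p0; apply/eqP/negP => /negP pn0.
have /(_ pn0) := @max_poly_roots _ p (map (fun k => k%:R) (iota 0 (size p))).
rewrite map_inj_uniq ?iota_uniq; last first.
  by move=> i j /eqP; rewrite eqr_nat => /eqP.
rewrite size_map size_iota ltnn => /(_ _ isT) absurd; suff: false by [].
by apply: absurd; apply/allP => t _; rewrite rootE p0.
Qed.

(** Vanishing everywhere passes to each partial derivative, so [mderiv_ind] applies and leaves only
    a constant with value 0. *)
Lemma meval_inj n (R : numDomainType) (p : {mpoly R[n]}) :
  (forall v, p.@[v] = 0) -> p = 0.
Proof.
elim/mderiv_ind: p => [c /(_ (fun=> 0))|p IHp p0].
  by rewrite mevalC => ->; rewrite mpolyC0.
suff dp0 i : p^`M(i) = 0.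
  by rewrite (mderiv_eq0 dp0); have := p0 (fun=> 0);
     rewrite {1}(mderiv_eq0 dp0) mevalC => ->; rewrite mpolyC0.
apply: IHp => v.
(* [line r] is the restriction of [r] to the line through [v] in direction [i], as a univariate
   polynomial; its derivative at 0 is the [i]-th partial derivative at [v]. *)
pose line (r : {mpoly R[n]}) : {poly R} :=
  mmap (@polyC R) (fun j => (v j)%:P + (j == i)%:R *: 'X) r.
have lineC c : line c%:MP = c%:P by exact: mmapC.
have lineX j : line 'X_j = (v j)%:P + (j == i)%:R *: 'X.
  by rewrite /line mmapX mmap1U.
have lineD r s : line (r + s) = line r + line s by exact: mmapD.
have lineM r s : line (r * s) = line r * line s by exact: rmorphM.
have lineE r t : (line r).[t] = r.@[fun j => v j + (j == i)%:R * t].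
  elim/mpoly_alg_ind: r => [c|j|r s IHr IHs|r s IHr IHs].
  - by rewrite lineC hornerC mevalC.
  - by rewrite lineX hornerD hornerZ hornerX hornerC mevalXU.
  - by rewrite lineD hornerD IHr IHs mevalD.
  - by rewrite lineM hornerM IHr IHs mevalM.
have lineE0 r : (line r).[0] = r.@[v].
  by rewrite lineE; apply: meval_eq => j; rewrite mulr0 addr0.
have lined r : (line r)^`().[0] = (r^`M(i)).@[v].
  elim/mpoly_alg_ind: r => [c|j|r s IHr IHs|r s IHr IHs].
  - by rewrite lineC derivC horner0 mderivC meval0.
  - rewrite lineX derivD derivC add0r derivZ derivX hornerZ hornerC mulr1.
    rewrite mderivX mnm1E; case: eqP => [->|_]; last by rewrite scale0r meval0.
    by rewrite mnm_subUU mpolyX0 scale1r meval1.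
  - by rewrite lineD derivD hornerD IHr IHs mderivD mevalD.
  - rewrite lineM derivM hornerD !hornerM IHr IHs !lineE0.
    by rewrite mderivM mevalD !mevalM.
rewrite -lined (_ : line p = 0) ?deriv0 ?horner0 //.
by apply: poly_all_roots => t; rewrite lineE p0.
Qed.

Lemma jacobian_alg_indep n k (R : numDomainType) (y : n.-tuple {mpoly R[k]})
    (f : 'I_n -> 'I_k) (v : 'I_k -> R) :
  (forall i j, ((tnth y i)^`M(f j)).@[v] = (i == j)%:R) ->
  forall P, P \mPo y = 0 -> P = 0.
Proof.
move=> yv P; elim/mderiv_ind: P => [c|P IHP Py].
  by rewrite comp_mpolyC => /eqP; rewrite mpolyC_eq0 => /eqP ->;
    rewrite mpolyC0.
pose J := \matrix_(i, j) (tnth y i)^`M(f j).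
have detJ : \det J != 0.
  apply/negP => /eqP detJ; have := congr1 (meval v) detJ.
  rewrite meval0 -det_map_mx /= (_ : map_mx _ _ = 1%:M) ?det1.
    by move/eqP; rewrite oner_eq0.
  by apply/matrixP => i j; rewrite !mxE yv.
pose u := \row_i (P^`M(i) \mPo y).
have uJ : u *m J = 0.
  apply/matrixP => i j; rewrite !mxE.
  transitivity (P \mPo y)^`M(f j); last by rewrite Py mderiv0.
  rewrite mderiv_comp.
  by apply: eq_bigr => l _; rewrite !mxE.
have u0 : u = 0.
  apply/eqP; have := congr1 (fun A => A *m \adj J) uJ.
  rewrite /= -mulmxA mul_mx_adj mul0mx mul_mx_scalar => /eqP.
  by rewrite scalemx_eq0 (negbTE detJ).
have dP0 i : P^`M(i) = 0.
  by apply: IHP; have := congr1 (fun A : 'rV_n => A 0 i) u0; rewrite /= !mxE.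
move: Py; rewrite (mderiv_eq0 dP0) comp_mpolyC => /eqP.
by rewrite mpolyC_eq0 => /eqP ->; rewrite mpolyC0.
Qed.

(* A polynomial ring is completely integrally closed: since
   theta^k P_(k+1) = P_1^(k+1) for all k, the leading monomial of theta divides
   that of P_1, and subtracting the quotient from p preserves the hypothesis. *)
Lemma almost_integral n k (F : fieldType) (y : n.-tuple {mpoly F[k]})
    (theta : {mpoly F[n]}) (p : {mpoly F[k]}) :
  (forall P : {mpoly F[n]}, P \mPo y = 0 -> P = 0) -> theta != 0 ->
  (forall j, exists P, (theta \mPo y) * p ^+ j = P \mPo y) ->
  exists P, p = P \mPo y.
Proof.
move=> yinj th0 hP; have [P1] := hP 1%N; rewrite expr1.
have yI (A B : {mpoly F[n]}) : A \mPo y = B \mPo y -> A = B.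
  by move=> AB; apply/eqP; rewrite -subr_eq0; apply/eqP/yinj;
    rewrite comp_mpolyB AB subrr.
have thy0 : theta \mPo y != 0 by apply: contra th0 => /eqP/yinj ->.
elim/mleadrect: P1 p hP => P1 IH p hP P1E.
have [P10|P1n0] := eqVneq P1 0.
  exists 0; move: P1E; rewrite P10 !comp_mpoly0 => /eqP.
  by rewrite mulf_eq0 (negbTE thy0) => /eqP.
have leth : (mlead theta <= mlead P1)%MM.
  apply/mnm_lepP => i; rewrite leqNgt; apply/negP => lti.
  (* If the exponent of [theta] at [i] is at least [j], the left side of [E] has exponent at least
     [j * j] there, whereas the right side has [(j - 1) * (j + 1)], which is smaller by one. *)
  pose j := (mlead P1 i).+1; have [Pj PjE] := hP j.+1.
  have E : theta ^+ j * Pj = P1 ^+ j.+1.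
    apply: yI; rewrite rmorphM !rmorphXn /= -PjE -P1E exprMn mulrA -exprSr //.
  have Pj0 : Pj != 0.
    by apply: contraTneq (expf_neq0 j.+1 P1n0) => Pj0;
      rewrite -E Pj0 mulr0 eqxx.
  have := congr1 (fun p => mlead p i) E.
  rewrite /= mleadM ?expf_neq0 // !mleadX // mnmDE !mulmnE -/j => /eqP.
  rewrite gtn_eqF //; apply: leq_trans (leq_addr _ _).
  apply: leq_trans (leq_mul lti (leqnn j)).
  by rewrite /j !mulnS mulSn addSn.
pose m := (mlead P1 - mlead theta)%MM; pose c := mleadc P1 / mleadc theta.
have c0 : c != 0 by rewrite mulf_neq0 ?invr_eq0 ?mleadc_eq0.
pose P2 := P1 - c *: 'X_[m] * theta.
have mth : mlead (c *: 'X_[m] * theta) = mlead P1.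
  by rewrite mleadM ?mleadZ ?mleadXm ?submK // scaler_eq0 (negbTE c0) /=
     -(mmeasure_poly_eq0 mdeg) msizeX.
pose p2 := p - ((c *: 'X_[m]) \mPo y).
have P2E : (theta \mPo y) * p2 = P2 \mPo y.
  by rewrite mulrBr P1E comp_mpolyB rmorphM [X in _ - X]mulrC.
have [Q QE] : exists Q, p2 = Q \mPo y.
  have [P20|P2n0] := eqVneq P2 0.
    exists 0; move: P2E; rewrite P20 !comp_mpoly0 => /eqP.
    by rewrite mulf_eq0 (negbTE thy0) => /eqP.
  apply: (IH P2) => //.
    rewrite lt_neqAle; apply/andP; split; last first.
      by rewrite (le_trans (mleadB_le _ _)) // leUx lexx mth lexx.
    apply/negP => /eqP ml; have := mleadc_eq0 P2; rewrite (negbTE P2n0) ml.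
    have lX : mleadc (c *: 'X_[m]) = c.
      by rewrite mleadcZE mleadXm mcoeffX eqxx mulr1.
    have lc : (c *: 'X_[m] * theta)@_(mlead P1) = mleadc P1.
      rewrite -{1}mth; rewrite {1}mleadM // ?mleadcM ?lX.
        by rewrite mulfVK // mleadc_eq0.
      by rewrite -mleadc_eq0 lX c0.
    by rewrite mcoeffB lc subrr eqxx.
  move=> j.
  have /fin_all_exists [f fE] (i : 'I_j.+1) := hP i.
  (* Binomial expansion of [p2 ^+ j], each [(theta \mPo y) * p ^+ i] being replaced by its
     expression [f i]. *)
  exists (\sum_(i < j.+1) (- (c *: 'X_[m])) ^+ (j - i) * f i *+ 'C(j, i)).
  rewrite rmorph_sum /p2 addrC exprDn mulr_sumr; apply: eq_bigr => i _ /=.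
  by rewrite rmorphMn rmorphM rmorphXn rmorphN /= -fE mulrnAr mulrCA.
exists (Q + c *: 'X_[m]); rewrite comp_mpolyD -QE subrK //.
Qed.

Lemma comp_mpolyA n k l (R : comNzRingType) (p : {mpoly R[n]})
    (y : n.-tuple {mpoly R[k]}) (z : k.-tuple {mpoly R[l]}) :
  (p \mPo y) \mPo z = p \mPo [tuple tnth y i \mPo z | i < n].
Proof.
elim/mpoly_alg_ind: p => [c|i|p r IHp IHr|p r IHp IHr].
- by rewrite !comp_mpolyC.
- by rewrite !comp_mpolyXU -!tnth_nth tnth_mktuple.
- by rewrite !comp_mpolyD IHp IHr.
- by rewrite !rmorphM /= IHp IHr.
Qed.

(** * Extension of multi-indices by zero along a map of index sets *)

Section MultiIndex.
Variables (m n : nat) (f : 'I_m -> 'I_n).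

(** For injective [f] this is extension by zero outside the image; summing over fibres makes it
    additive for every [f]. *)
Definition mnm_ext (a : 'X_{1..m}) : 'X_{1..n} :=
  [multinom (\sum_(i | f i == j) a i)%N | j < n].

Lemma mnm_extD a c : mnm_ext (a + c) = (mnm_ext a + mnm_ext c)%MM.
Proof.
apply/mnmP => j; rewrite mnmDE !mnmE -big_split.
by apply: eq_bigr => i _; rewrite mnmDE.
Qed.

Lemma mnm_ext0 : mnm_ext 0 = 0%MM.
Proof.
by apply/mnmP => j; rewrite mnmE mnm0E big1 // => i _; rewrite mnm0E.
Qed.

Lemma mnm_extU i : mnm_ext U_(i) = U_(f i)%MM.
Proof.
apply/mnmP => j; rewrite mnmE mnm1E; case: eqP => fij.
  rewrite (bigD1 i) ?fij //= mnm1E eqxx big1 ?addn0 // => l /andP[_ li].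
  by rewrite mnm1E eq_sym (negbTE li).
rewrite big1 // => l /eqP flj; rewrite mnm1E; case: eqP => // il.
by case: fij; rewrite il.
Qed.

Lemma big_codom (R : Type) (idx : R) (op : Monoid.com_law idx) (F : 'I_n -> R) :
  injective f ->
  \big[op/idx]_(j in codom f) F j = \big[op/idx]_i F (f i).
Proof.
move=> finj; rewrite -(big_imset _ (A := 'I_m)); last by move=> i j _ _ /finj.
apply: eq_bigl => j; apply/codomP/imsetP => [[i ->]|[i _ ->]];
  first by exists i.
by exists i.
Qed.

Lemma mnm_extE a i : injective f -> mnm_ext a (f i) = a i.
Proof.
move=> finj; rewrite mnmE (big_pred1 i) // => l /=.
by rewrite (inj_eq finj).
Qed.

Lemma big_mnm_ext (R : Type) (idx : R) (op : Monoid.com_law idx)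
    (F : 'I_n -> nat -> R) a : injective f ->
  (forall j, F j 0%N = idx) ->
  \big[op/idx]_j F j (mnm_ext a j) = \big[op/idx]_i F (f i) (a i).
Proof.
move=> finj F0; rewrite (bigID (mem (codom f))) /= [X in op _ X]big1;
  last first.
  move=> j jf; rewrite mnmE big1 // => i /eqP fij.
  by rewrite -fij codom_f in jf.
rewrite Monoid.mulm1 big_codom //.
by apply: eq_bigr => i _; rewrite mnm_extE.
Qed.

Lemma mdeg_ext a : injective f -> mdeg (mnm_ext a) = mdeg a.
Proof. by move=> finj; rewrite !mdegE (@big_mnm_ext _ _ _ (fun _ k => k)). Qed.

(** Multi-indices not supported on the image of [f] contribute 0. The others correspond bijectively
    to multi-indices on ['I_m], with the same total degree and hence the same bound [N]. *)
Lemma sum_mnm_ext (W : nmodType) N (P : pred 'X_{1..n}) (F : 'X_{1..n} -> W) :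
  injective f ->
  (forall a j, P a -> j \notin codom f -> a j != 0%N -> F a = 0) ->
  \sum_(a : 'X_{1..n < N} | P a) F a =
  \sum_(a : 'X_{1..m < N} | P (mnm_ext a)) F (mnm_ext a).
Proof.
move=> finj F0.
pose supp (a : 'X_{1..n}) := [forall j, (j \notin codom f) ==> (a j == 0%N)].
rewrite (bigID (fun a : 'X_{1..n < N} => supp a)) /= [X in _ + X]big1 ?addr0;
  last first.
  move=> a /andP[Pa]; rewrite negb_forall => /existsP[j].
  rewrite negb_imply => /andP[jf aj]; exact: F0 Pa jf aj.
pose res (a : 'X_{1..n}) : 'X_{1..m} := [multinom a (f i) | i < m].
have resK (a : 'X_{1..n}) : supp a -> mnm_ext (res a) = a.
  move=> /forallP sa; apply/mnmP => j.
  have [/codomP[i ->]|jf] := boolP (j \in codom f).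
    by rewrite mnm_extE // mnmE.
  have /eqP -> := implyP (sa j) jf; rewrite mnmE big1 // => i /eqP fij.
  by rewrite -fij codom_f in jf.
have extK (a : 'X_{1..m}) : res (mnm_ext a) = a.
  by apply/mnmP => i; rewrite mnmE mnm_extE.
have supp_ext (a : 'X_{1..m}) : supp (mnm_ext a).
  apply/forallP => j; apply/implyP => jf; rewrite mnmE big1 // => i /eqP fij.
  by rewrite -fij codom_f in jf.
have res_deg (a : 'X_{1..n}) : (mdeg (res a) <= mdeg a)%N.
  rewrite !mdegE; under eq_bigr do rewrite mnmE.
  rewrite -(big_codom _ (fun j => a j)) // [leqRHS](bigID (mem (codom f))).
  exact: leq_addr.
have ext_bd (a : 'X_{1..m < N}) : (mdeg (mnm_ext a) < N)%N.
  by rewrite mdeg_ext // bmdeg.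
have res_bd (a : 'X_{1..n < N}) : (mdeg (res a) < N)%N.
  by rewrite (leq_ltn_trans (res_deg a)) // bmdeg.
rewrite (reindex_onto (fun a => BMultinom (ext_bd a))
  (fun a => BMultinom (res_bd a))) /=.
  apply: eq_bigl => a; rewrite supp_ext andbT.
  suff -> : BMultinom (res_bd (BMultinom (ext_bd a))) = a by rewrite eqxx andbT.
  by apply: val_inj; rewrite /= extK.
by move=> a /andP[_ /resK sa]; apply: val_inj.
Qed.

End MultiIndex.

(** * Polynomial functions, and the chain rule for pullbacks in coordinates *)

Section PolynomialFunctionTheory.
Variable C : numClosedFieldType.
Implicit Types U V : vectType C.

Lemma pevalE V (p : Spoly V) (w : 'I_(\dim {:V}) -> C) :
  p.@[w] = peval p (\sum_i w i *: (vbasis {:V})`_i).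
Proof.
rewrite /peval; apply: meval_eq => i; rewrite tnth_mktuple.
by rewrite coord_sum_free // (basis_free (vbasisP _)).
Qed.

Lemma peval_inj V (p r : Spoly V) : peval p =1 peval r -> p = r.
Proof.
move=> pr; apply/eqP; rewrite -subr_eq0; apply/eqP/meval_inj => w.
by rewrite mevalB !pevalE pr subrr.
Qed.

Lemma pevalM V (p r : Spoly V) v : peval (p * r) v = peval p v * peval r v.
Proof. exact: mevalM. Qed.

Lemma pevalXn V (p : Spoly V) k v : peval (p ^+ k) v = peval p v ^+ k.
Proof. exact: rmorphXn. Qed.

Lemma peval_sum V (T : Type) (r : seq T) (P : pred T) (F : T -> Spoly V) v :
  peval (\sum_(i <- r | P i) F i) v = \sum_(i <- r | P i) peval (F i) v.
Proof. exact: rmorph_sum. Qed.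

Lemma peval_comp V n (P : {mpoly C[n]}) (y : n.-tuple (Spoly V)) v :
  peval (P \mPo y) v = P.@[fun i => peval (tnth y i) v].
Proof. exact: comp_mpoly_meval. Qed.

Lemma peval_homog V d (p : Spoly V) c v :
  p \is d.-homog -> peval p (c *: v) = c ^+ d * peval p v.
Proof.
move=> /dhomogP hp; rewrite /peval !mevalE mulr_sumr !big_seq.
apply: eq_bigr => m /hp /esym mE; rewrite mulrCA; congr (_ * _).
have -> : d = mdeg m by [].
rewrite mdegE expr_sum -big_split; apply: eq_bigr => i _ /=.
by rewrite !tnth_mktuple linearZ exprMn.
Qed.

Lemma pullback_homog U V d (h : 'Hom(U, V)) (p : Spoly V) :
  p \is d.-homog -> pullback h p \is d.-homog.
Proof.
move=> /dhomogP hp; rewrite /pullback comp_mpolyE big_seq.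
apply: rpred_sum => m /hp /esym mE; apply: rpredZ.
have -> : d = mdeg m by [].
rewrite mdegE; elim/big_rec2: _ => [|i e r _ hr]; first exact: dhomog1.
apply: dhomogM => //; rewrite -[X in X.-homog]mul1n; apply: dhomogMn.
rewrite tnth_mktuple; apply: rpred_sum => j _; apply: rpredZ.
by rewrite dhomogX /= mdeg1.
Qed.

Lemma coords_sum V n (b : n.-tuple V) (w : 'I_n -> C) :
  free b -> tnth (coords b (\sum_i w i *: b`_i)) =1 w.
Proof. by move=> bf i; rewrite tnth_mktuple coord_sum_free. Qed.

Section Pullback.
Variables (U V : vectType C) (m n : nat).
Variables (b' : m.-tuple U) (b : n.-tuple V) (h : 'Hom(U, V)).
Hypotheses (b'U : basis_of {:U} b') (bV : basis_of {:V} b).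

(** The matrix of [h] in the bases [b'] and [b], as a tuple of linear forms: entry [j] is the
    pullback of the [j]-th coordinate of [V]. *)
Let sigma : n.-tuple {mpoly C[m]} :=
  [tuple \sum_i coord b j (h (tnth b' i)) *: 'X_i | j < n].

Lemma in_coords_pullback (p : Spoly V) :
  in_coords b' (pullback h p) = in_coords b p \mPo sigma.
Proof.
apply/eqP; rewrite -subr_eq0; apply/eqP/meval_inj => w.
pose u := \sum_i w i *: b'`_i.
have wE := coords_sum w (basis_free b'U).
rewrite mevalB -!(meval_eq _ wE) meval_in_coords // peval_pullback.
rewrite comp_mpoly_meval -(meval_in_coords p (h _) bV).
apply/eqP; rewrite subr_eq0; apply/eqP/meval_eq => j.
rewrite !tnth_mktuple rmorph_sum !linear_sum; apply: eq_bigr => i _ /=.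
by rewrite !linearZ /= mevalXU wE mulrC (tnth_nth 0).
Qed.

Lemma tnth_sigma_meval u :
  (fun j => (tnth sigma j).@[tnth (coords b' u)]) =1 tnth (coords b (h u)).
Proof.
move=> j; rewrite !tnth_mktuple {2}(coord_basis b'U (memvf u)).
rewrite rmorph_sum !linear_sum; apply: eq_bigr => i _ /=.
by rewrite !linearZ /= mevalXU tnth_mktuple mulrC (tnth_nth 0).
Qed.

Lemma mderiv_sigma i j : (tnth sigma j)^`M(i) = (coord b j (h (tnth b' i)))%:MP.
Proof.
rewrite tnth_mktuple linear_sum (bigD1 i) //= big1 ?addr0 => [|l li].
  by rewrite mderivZ mderivX mnm1E eqxx mnm_subUU mpolyX0 scale1r alg_mpolyC.
by rewrite mderivZ mderivX mnm1E (negbTE li) scale0r scaler0.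
Qed.

Lemma partialU_pullback i (p : Spoly V) u :
  partial b' U_(i) (pullback h p) u =
  \sum_j partial b U_(j) p (h u) * coord b j (h (tnth b' i)).
Proof.
rewrite /partial mderivmU1m in_coords_pullback mderiv_comp rmorph_sum.
apply: eq_bigr => j _ /=; rewrite rmorphM /= comp_mpoly_meval mderivmU1m.
rewrite (meval_eq _ (tnth_sigma_meval u)); congr (_ * _).
by rewrite mderiv_sigma mevalC.
Qed.

(** As [h] sends basis vectors to basis vectors, the derivatives of [sigma] are 0 or 1, so deriving
    along [i] after substitution amounts to deriving along [f i] before it. Induction on [mdeg a]
    does the rest. *)
Lemma partial_pullback (f : 'I_m -> 'I_n) a (p : Spoly V) u :
  (forall i, h (tnth b' i) = tnth b (f i)) ->
  partial b' a (pullback h p) u = partial b (mnm_ext f a) p (h u).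
Proof.
move=> hb; have bf := basis_free bV.
have dsigma i F : (F \mPo sigma)^`M(i) = F^`M(f i) \mPo sigma.
  rewrite mderiv_comp (bigD1 (f i)) //= big1 ?addr0 => [|j jf].
    by rewrite mderiv_sigma hb (tnth_nth 0) coord_free // eqxx mpolyC1 mulr1.
  rewrite mderiv_sigma hb (tnth_nth 0) coord_free //.
  by rewrite ?[f i == j]eq_sym (negbTE jf) mpolyC0 mulr0.
rewrite /partial in_coords_pullback.
suff -> : forall F, (F \mPo sigma)^`M[a] = F^`M[mnm_ext f a] \mPo sigma.
  rewrite comp_mpoly_meval; exact: meval_eq (tnth_sigma_meval u).
move: {2}(mdeg a) (erefl (mdeg a)) => k; elim: k a => [|k IHk] a.
  move/eqP; rewrite mdeg_eq0 => /eqP -> F.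
  by rewrite mnm_ext0 !mderivm0m.
move=> ak; have /existsP [i ai] : [exists i, a i != 0%N].
  rewrite -negb_forall; apply: contra_eqN ak => /forallP a0.
  by rewrite mdegE big1 // => i _; rewrite (eqP (a0 i)).
rewrite -mnm_lepU in ai; move: ak; rewrite -(submK ai) mdegD mdeg1 addn1.
move=> [/IHk IH] F; rewrite addmC mderivmDm mderivmU1m dsigma IH.
by rewrite mnm_extD mnm_extU mderivmDm mderivmU1m.
Qed.

End Pullback.

End PolynomialFunctionTheory.

(** * Finite linear groups: inverses, translation of sums, stabilizers *)

Section LinearGroup.
Variables (C : numClosedFieldType) (V : vectType C) (G : {fset 'End(V)}).
Hypothesis Ggrp : finite_linear_group G.
Implicit Types s t : 'End(V).

Lemma lfun_powE s k v : lfun_pow s k v = iter k s v.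
Proof.
rewrite /lfun_pow; elim: k => [|k IHk]; rewrite /= ?id_lfunE //.
by rewrite comp_lfunE IHk.
Qed.

Lemma group_lfun_pow s k : s \in G -> lfun_pow s k \in G.
Proof.
have [G1 GM _] := Ggrp; move=> sG; elim: k => [//|k IHk].
exact: GM.
Qed.

(** The group axioms give left inverses only; the left inverse [t] of [s] has a left inverse of its
    own, which forces [t] to be two-sided. *)
Lemma group_inv s : s \in G -> exists t, [/\ t \in G, cancel s t & cancel t s].
Proof.
have [_ _ GV] := Ggrp; move=> /GV[t tG ts]; have [u uG ut] := GV t tG.
have stK : cancel s t by move=> v; rewrite -comp_lfunE ts id_lfunE.
have tuK : cancel t u by move=> v; rewrite -comp_lfunE ut id_lfunE.
exists t; split=> // v; by rewrite -[LHS]tuK stK tuK.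
Qed.

Lemma group_lfun_invK s : s \in G -> cancel s (s^-1)%VF.
Proof.
move=> /group_inv[t [_ stK _]] v; apply: lker0_lfunK.
by apply/lker0P; apply: can_inj stK.
Qed.

(** Right translation by [t] maps the finite set [G] injectively into itself, hence permutes it. *)
Lemma sum_group_shift (W : nmodType) (F : 'End(V) -> W) t : t \in G ->
  \sum_(s <- G) F (s \o t)%VF = \sum_(s <- G) F s.
Proof.
move=> tG; have [_ GM _] := Ggrp; have [u [uG _ tuK]] := group_inv tG.
have shift_inj : injective (fun s => s \o t)%VF.
  move=> s1 s2 s12; apply/lfunP => v.
  by rewrite -[v]tuK -!comp_lfunE s12.
rewrite -(big_map (fun s => (s \o t)%VF) xpredT) /=; apply: perm_big.
have sub : {subset [seq (s \o t)%VF | s <- G] <= G}.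
  by move=> _ /mapP[s sG ->]; apply: GM.
have Guniq : uniq [seq (s \o t)%VF | s <- G] by rewrite map_inj_uniq ?fset_uniq.
have [_ eqG] := uniq_min_size Guniq sub (eq_leq (esym (size_map _ _))).
by apply: uniq_perm => //; rewrite fset_uniq.
Qed.

(* If [s] fixes [q], differentiating [x_i \o s = x_i] at [q] shows that [s]
   preserves every coordinate form. *)
Lemma compatible_stabilizer n (b : n.-tuple V) (x : n.-tuple (Spoly V)) q s :
  basis_of {:V} b -> compatible b x q ->
  (forall i, Defs.invariant G (tnth x i)) -> s \in G -> s q = q -> s = \1%VF.
Proof.
move=> bV xq xG sG sq; apply/lfunP => v.
rewrite [v](coord_basis bV (memvf v)) linear_sum linear_sum.
apply: eq_bigr => i _ /=; rewrite !linearZ; congr (_ *: _) => /=.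
rewrite id_lfunE [LHS](coord_basis bV (memvf _)) (bigD1 i) //= big1 => [|l li].
  have := partialU_pullback s bV bV i (tnth x i) q.
  rewrite xG // xq eqxx sq (bigD1 i) //= big1 => [|j ji].
    by rewrite xq eqxx mul1r !addr0 (tnth_nth 0) => <-; rewrite scale1r.
  by rewrite xq eq_sym (negbTE ji) mul0r.
have := partialU_pullback s bV bV i (tnth x l) q.
rewrite xG // xq (negbTE li) sq (bigD1 l) //= big1 => [|j jl].
  by rewrite xq eqxx mul1r !addr0 (tnth_nth 0) => <-; rewrite scale0r.
by rewrite xq eq_sym (negbTE jl) mul0r.
Qed.

End LinearGroup.

(** * Separating a point from another point or from a subspace *)

Section Separation.
Variables (C : numClosedFieldType) (V : vectType C).

Lemma separate_point (w q : V) : w != q ->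
  exists l : Spoly V, peval l q = 1 /\ peval l w = 0.
Proof.
move=> wq; have [i qwi] : exists i, coord (vbasis {:V}) i (q - w) != 0.
  apply/existsP; rewrite -negb_forall; apply: contra wq => /forallP qw0.
  rewrite eq_sym -subr_eq0 (coord_vbasis (memvf (q - w))) big1 // => i _.
  by rewrite (eqP (qw0 i)) scale0r.
(* A coordinate in which [q] and [w] differ, shifted to vanish at [w] and scaled to be 1 at [q]. *)
exists ((coord (vbasis {:V}) i (q - w))^-1 *:
        ('X_i - (coord (vbasis {:V}) i w)%:MP)).
split; rewrite /peval mevalZ mevalB mevalC mevalXU tnth_mktuple.
  by rewrite -linearB mulVf.
by rewrite subrr mulr0.
Qed.

Lemma separate_subspace (W : {vspace V}) (q : V) : q \notin W ->
  exists l : Spoly V, peval l q = 1 /\ {in W, forall w, peval l w = 0}.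
Proof.
(* [h] is the projection with kernel [W], so it suffices to separate [h q] from 0 and pull back. *)
move=> qW; pose h : 'End(V) := (\1 - projv W)%VF.
have hW : {in W, forall w, h w = 0}.
  by move=> w wW; rewrite add_lfunE opp_lfunE id_lfunE projv_id // subrr.
have hq : 0 != h q.
  apply: contra qW; rewrite add_lfunE opp_lfunE id_lfunE eq_sym subr_eq0.
  by move=> /eqP ->; apply: memv_proj.
have [l [lq l0]] := separate_point hq.
exists (pullback h l); rewrite peval_pullback; split=> // w wW.
by rewrite peval_pullback hW.
Qed.

End Separation.

(** * Subtuples indexed by a subset *)

Section Subtuple.
Variables (n : nat) (I : {set 'I_n}).

Lemma tnth_subtuple (T : Type) (t : n.-tuple T) i :
  tnth (subtuple I t) i = tnth t (enum_val i).
Proof. by rewrite tnth_mktuple. Qed.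

Lemma map_enum_val : [seq enum_val i | i <- enum 'I_#|I|] = enum I.
Proof.
have [I0|[x0 x0I]] := set_0Vmem I.
  apply/eqP; rewrite I0 enum_set0 -size_eq0 size_map size_enum_ord.
  by rewrite cards0.
apply: (@eq_from_nth _ x0); rewrite size_map size_enum_ord -?cardE // => i iI.
by rewrite (nth_map (Ordinal iI)) ?size_enum_ord // (enum_val_nth x0)
  nth_enum_ord.
Qed.

Lemma val_subtuple (T : Type) (t : n.-tuple T) :
  subtuple I t = [seq tnth t i | i <- enum I] :> seq T.
Proof.
have -> : [seq tnth t i | i <- enum I] =
          [seq tnth t (enum_val i) | i <- enum 'I_#|I|].
  by rewrite -{1}map_enum_val -map_comp.
rewrite -(map_tnth_enum (subtuple I t)).
by apply: eq_map => i; rewrite tnth_subtuple.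
Qed.

Lemma subtuple_subseq (T : eqType) (t : n.-tuple T) : subseq (subtuple I t) t.
Proof.
rewrite val_subtuple -[X in subseq _ X]map_tnth_enum.
apply: map_subseq.
have -> : enum I = [seq i <- enum 'I_n | i \in I] by rewrite !enumT.
exact: filter_subseq.
Qed.

Lemma codom_enum_val j : (j \in codom (enum_val (A := I))) = (j \in I).
Proof.
apply/codomP/idP => [[i ->]|jI]; first exact: enum_valP.
by exists (enum_rank_in jI j); rewrite enum_rankK_in.
Qed.

End Subtuple.

(** The enumeration of [I] is increasing, so index 0 stays first. This serves for both the top
    degree and the first coordinate of [q]. *)
Lemma head_subtuple n (I : {set 'I_n}) (T : Type) (x0 : T) (t : n.-tuple T) :
  (0 < n)%N -> (forall i : 'I_n, i = 0%N :> nat -> i \in I) ->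
  head x0 (subtuple I t) = head x0 t.
Proof.
case: n I t => [//|n] I t _ /(_ ord0 erefl) I0.
have enumI : enum I = [seq i <- enum 'I_n.+1 | i \in I] by rewrite !enumT.
rewrite val_subtuple enumI enum_ordSl /= I0 /=.
by case/tupleP: t => t0 t /=; rewrite (tnth_nth t0).
Qed.

(** * The eigenspace [E] in graded coordinates *)

Section Subquotient.
Variables (C : numClosedFieldType) (V : vectType C) (n : nat).
Variables (G : {fset 'End(V)}) (d : n.-tuple nat) (g : 'End(V)) (zeta : C).
Variables (q : V) (b : n.-tuple V) (x : n.-tuple (Spoly V)) (delta : nat).
Hypothesis Ggrp : finite_linear_group G.
Hypothesis data : pvf_data G d g zeta q b x.
Hypothesis dvd_delta : (delta %| top_degree d)%N.

Local Notation k := (top_degree d %/ delta)%N.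
Local Notation E := (passmx.leigenspace (lfun_pow g k) (zeta ^+ k)).
Local Notation I := (divisible_indices d delta).
Local Notation f := (enum_val (A := I)).

Let zprim : (top_degree d).-primitive_root zeta.
Proof. by have [[]] := data. Qed.

Let gG : g \in G.
Proof. by have [[_ []]] := data. Qed.

Let gq : g q = zeta *: q.
Proof. by have [[]] := data. Qed.

Let bV : basis_of {:V} b.
Proof. by have [_ []] := data. Qed.

Let xhom i : tnth x i \is (tnth d i).-homog.
Proof. by have [_ _ [_ _ /(_ i)[]]] := data. Qed.

Let xinv i : Defs.invariant G (tnth x i).
Proof. by have [_ _ [_ _ /(_ i)[]]] := data. Qed.

Let xcomp : compatible b x q.
Proof. by have [_ _ _ _] := data. Qed.

Let zeta_neq0 : zeta != 0.
Proof.
apply: contraTneq (oner_neq0 C) => z0; rewrite -(prim_expr_order zprim) z0.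
by rewrite expr0n gtn_eqF ?(prim_order_gt0 zprim) // eqxx.
Qed.

Let top_delta : (k * delta)%N = top_degree d.
Proof. exact: divnK. Qed.

(** An invariant of degree 0 would be constant, against its derivative along coordinate [i] being 1
    at [q]. *)
Lemma degree_gt0 i : (0 < tnth d i)%N.
Proof.
rewrite lt0n; apply/eqP => di0.
have xi0 : tnth x i = (peval (tnth x i) 0)%:MP.
  apply: peval_inj => v; rewrite [RHS]mevalC -(scale0r v).
  by rewrite (peval_homog 0 v (xhom i)) di0 expr0 mul1r.
have := xcomp i i; rewrite /partial xi0 /in_coords comp_mpolyC mderivmU1m.
by rewrite mderivC meval0 eqxx => /esym/eqP; rewrite oner_eq0.
Qed.

Lemma coord_iter i j v :
  coord b i v = zeta ^+ ((tnth d i).-1 * j) * coord b i (iter j g v).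
Proof.
have [_ [_ gb] _ _ _] := data.
elim: j => [|j IHj]; first by rewrite muln0 expr0 mul1r.
rewrite IHj mulnS addnC exprD -mulrA; congr (_ * _); rewrite iterS -gb.
by rewrite (group_lfun_invK Ggrp).
Qed.

(** The order of [zeta] is [k * delta], which divides [k * tnth d i] exactly when [delta] divides
    [tnth d i]. *)
Lemma zeta_expk i : (zeta ^+ (k * tnth d i) == 1) = (i \in I).
Proof.
rewrite -(prim_order_dvd zprim) inE -{1}top_delta dvdn_pmul2l //.
have := prim_order_gt0 zprim; rewrite -{1}top_delta.
by rewrite muln_gt0 => /andP[].
Qed.

Lemma mem_eigenspace v : (v \in E) = (lfun_pow g k v == zeta ^+ k *: v).
Proof.
by rewrite memv_ker add_lfunE opp_lfunE scale_lfunE id_lfunE subr_eq0.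
Qed.

(** By [coord_iter], the eigenvector equation says in coordinate [i] that the coordinate is
    unchanged by the factor [zeta ^+ (k * tnth d i)]. This is no condition for [i] in [I], and
    forces it to vanish otherwise. *)
Lemma coord_eigenspace v : (v \in E) =
  [forall (i | i \notin I), coord b i v == 0].
Proof.
have dE i : (tnth d i * k = (tnth d i).-1 * k + k)%N.
  by rewrite -{1}(prednK (degree_gt0 i)) mulSn addnC.
have zE i v1 : zeta ^+ ((tnth d i).-1 * k) * coord b i (zeta ^+ k *: v1) =
    zeta ^+ (k * tnth d i) * coord b i v1.
  by rewrite linearZ /= mulrA -exprD -dE mulnC.
rewrite mem_eigenspace lfun_powE; apply/eqP/'forall_implyP => [hv i iI|v0].
  have := coord_iter i k v; rewrite hv zE => /eqP.
  rewrite -subr_eq0 -{1}[coord b i v]mul1r -mulrBl mulf_eq0 subr_eq0 eq_sym.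
  by rewrite zeta_expk (negbTE iI) orFb => ->.
rewrite [LHS](coord_basis bV (memvf _)) [RHS](coord_basis bV (memvf _)).
apply: eq_bigr => i _; congr (_ *: _).
have z0 : zeta ^+ ((tnth d i).-1 * k) != 0 by rewrite expf_neq0.
apply: (mulfI z0); rewrite -coord_iter zE.
have [iI|iI] := boolP (i \in I); last by rewrite (eqP (v0 i iI)) mulr0.
by rewrite -zeta_expk in iI; rewrite (eqP iI) mul1r.
Qed.

Lemma eigenspace_q : q \in E.
Proof.
rewrite mem_eigenspace lfun_powE; elim: k => [|j /eqP IHj].
  by rewrite expr0 scale1r.
by rewrite iterS IHj linearZ /= gq scalerA exprSr.
Qed.

(** The vectors of [b] with index in [I] already lie in [E], so [vsproj] only changes their type. *)
Definition sub_basis : #|I|.-tuple (subvs_of E) :=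
  [tuple vsproj E (tnth b (f i)) | i < #|I|].
Arguments sub_basis : simpl never.
Local Notation b' := sub_basis.
Local Notation q' := (vsproj E q).

Lemma val_q : vsval q' = q.
Proof. exact: vsprojK eigenspace_q. Qed.

Lemma val_sub_basis i : vsval (tnth b' i) = tnth b (f i).
Proof.
rewrite tnth_mktuple vsprojK // coord_eigenspace.
apply/'forall_implyP => j jI; rewrite (tnth_nth 0) coord_free //;
  last exact: basis_free bV.
rewrite pnatr_eq0 eqb0; apply: contraNneq jI => <-.
exact: enum_valP.
Qed.

Lemma val_sub_basis_sum (w : 'I_#|I| -> C) :
  vsval (\sum_j w j *: b'`_j) = \sum_j w j *: b`_(f j).
Proof.
rewrite linear_sum; apply: eq_bigr => j _; rewrite linearZ -tnth_nth.
by rewrite -(tnth_nth 0 b) -val_sub_basis.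
Qed.

Lemma coord_val_sum (w : 'I_#|I| -> C) i :
  coord b (f i) (vsval (\sum_j w j *: b'`_j)) = w i.
Proof.
rewrite val_sub_basis_sum linear_sum (bigD1 i) //= big1 => [|j ji].
  by rewrite linearZ /= coord_free ?(basis_free bV) // eqxx mulr1 addr0.
rewrite linearZ /= coord_free ?(basis_free bV) // (inj_eq enum_val_inj).
by rewrite (negbTE ji) mulr0.
Qed.

Lemma sub_basis_free : free b'.
Proof.
apply/freeP => w w0 i; rewrite -(coord_val_sum w i) w0.
by rewrite !linear0.
Qed.

Lemma sub_coord_sum u : u = \sum_i coord b (f i) (vsval u) *: b'`_i.
Proof.
apply: val_inj; rewrite /= val_sub_basis_sum [LHS](coord_basis bV (memvf _)).
rewrite (bigID (mem (codom f))) /= big_codom; last exact: enum_val_inj.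
rewrite [X in _ + X]big1 ?addr0 // => j jf.
have := subvsP u; rewrite coord_eigenspace => /'forall_implyP/(_ j).
by rewrite -codom_enum_val => /(_ jf)/eqP ->; rewrite scale0r.
Qed.

Lemma sub_basisP : basis_of {:subvs_of E} b'.
Proof.
rewrite basisEfree sub_basis_free subvf /=.
have -> : {:subvs_of E}%VS = <<b'>>%VS.
  apply/vspaceP => u; rewrite memvf [u]sub_coord_sum;
    apply/esym/memv_suml => i _.
  by apply/memvZ/memv_span/mem_nth; rewrite size_tuple.
exact: dim_span.
Qed.

Lemma coord_sub_basis i u : coord b' i u = coord b (f i) (vsval u).
Proof. by rewrite {1}[u]sub_coord_sum coord_sum_free // sub_basis_free. Qed.

(** * Restriction of invariants to [E] *)

Lemma peval_restrict p u : peval (restrict_poly E p) u = peval p (vsval u).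
Proof. by rewrite peval_pullback lfunE. Qed.

(** The power [lfun_pow g k] acts on [E] as the scalar [zeta ^+ k]. Invariance and homogeneity thus
    multiply the values on [E] by [zeta ^+ (k * tnth d i)], which differs from 1. *)
Lemma restrict_basic_invariant0 i : i \notin I ->
  restrict_poly E (tnth x i) = 0.
Proof.
move=> iI; apply: peval_inj => u; rewrite peval_restrict [RHS]meval0.
have hG : lfun_pow g k \in G by apply: group_lfun_pow.
have := subvsP u; rewrite mem_eigenspace => /eqP hu.
have := peval_pullback (lfun_pow g k) (tnth x i) (vsval u).
rewrite xinv // hu (peval_homog _ _ (xhom i)) -exprM => /eqP.
rewrite -subr_eq0 -{1}[peval _ _]mul1r -mulrBl mulf_eq0 subr_eq0 eq_sym.
by rewrite zeta_expk (negbTE iI) => /eqP.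
Qed.

Definition sub_invariants : #|I|.-tuple (Spoly (subvs_of E)) :=
  map_tuple (restrict_poly E) (subtuple I x).
Local Notation y := sub_invariants.

Lemma tnth_sub_invariants i : tnth y i = restrict_poly E (tnth x (f i)).
Proof. by rewrite tnth_map tnth_subtuple. Qed.

Lemma partial_restrict a p :
  partial b' a (restrict_poly E p) q' = partial b (mnm_ext f a) p q.
Proof.
have hb i : inclusion E (tnth b' i) = tnth b (f i).
  by rewrite lfunE; exact: val_sub_basis.
by rewrite (partial_pullback sub_basisP bV _ _ _ hb) lfunE /= val_q.
Qed.

Lemma sub_compatible : compatible b' y q'.
Proof.
move=> i j; rewrite tnth_sub_invariants partial_restrict mnm_extU xcomp.
by rewrite (inj_eq enum_val_inj).
Qed.

Lemma sub_invariants_indep (P : {mpoly C[#|I|]}) : P \mPo y = 0 -> P = 0.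
Proof.
(* [z] is [y] written in the coordinates of [b']; by compatibility its Jacobian at [q'] is the
   identity. *)
move=> Py; pose z := [tuple in_coords b' (tnth y i) | i < #|I|].
apply: (@jacobian_alg_indep _ _ _ z id (tnth (coords b' q'))) => [i j|].
  by rewrite tnth_mktuple -mderivmU1m -[LHS]/(partial _ _ _ _) sub_compatible.
have := congr1 (in_coords b') Py; rewrite /in_coords comp_mpolyA comp_mpoly0.
by [].
Qed.

Lemma subquotientP r : reflect
  (exists s, [/\ s \in G, (s @: E <= E)%VS & r = restrict_end E s])
  (r \in subquotient E G).
Proof.
apply: (iffP (imfsetP _ _ _ _)) => [[s]|[s [sG sE ->]]].
  by rewrite !inE => /andP[sG sE] ->; exists s.
by exists s => //; rewrite !inE sG.
Qed.

Lemma restrict_endE s u : (s @: E <= E)%VS ->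
  vsval (restrict_end E s u) = s (vsval u).
Proof.
move=> sE; rewrite -[restrict_end E s]/(linfun (vsproj E \o (s \o vsval))).
rewrite lfunE /= vsprojK //; apply: (subvP sE).
exact/memv_img/subvsP.
Qed.

Lemma restrict_invariant p :
  Defs.invariant G p -> Defs.invariant (subquotient E G) (restrict_poly E p).
Proof.
move=> pG _ /subquotientP[s [sG sE ->]]; apply: peval_inj => u.
rewrite peval_pullback !peval_restrict restrict_endE //.
by rewrite -peval_pullback pG.
Qed.

(** * Generation of the invariants of the subquotient *)

Let stab_q s : s \in G -> s q = q -> s = \1%VF.
Proof. exact: (compatible_stabilizer bV xcomp xinv). Qed.

(* [s h s^-1] and [h := g ^+ k] agree at [q], hence are equal, so that [s]
   commutes with [h] and preserves its eigenspaces. *)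
Lemma stabilizer_of_orbit s u : s \in G -> u \in E -> s u = q ->
  (s @: E <= E)%VS.
Proof.
have [_ GM _] := Ggrp; pose h := lfun_pow g k.
have hG : h \in G by apply: group_lfun_pow.
have hE v : v \in E -> h v = zeta ^+ k *: v by rewrite mem_eigenspace => /eqP.
move=> sG uE su; have [s1 [s1G sK s1K]] := group_inv Ggrp sG.
have [h1 [h1G hK h1K]] := group_inv Ggrp hG.
(* Here [s1 q = u], and [h] scales both [u] and [q] by [zeta ^+ k]. *)
have r1 : (h1 \o (s \o (h \o s1)))%VF = \1%VF.
  apply: stab_q; first by rewrite !GM.
  by rewrite !comp_lfunE -{1}su sK hE // linearZ /= su -hE ?hK // eigenspace_q.
apply/subvP => _ /memv_imgP[v vE ->]; rewrite mem_eigenspace -/h; apply/eqP.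
have := congr1 (fun r : 'End(V) => h (r (s v))) r1.
by rewrite /= !comp_lfunE id_lfunE h1K sK hE // linearZ => <-.
Qed.

(** A product with one factor per [s] in [L]. If [s] does not preserve [E], then [q] is outside
    [s @: E] by [stabilizer_of_orbit]; if it does and is not the identity, then [s q] differs from
    [q] by [stab_q]. Either way a factor with value 1 at [q] exists. *)
Lemma separating_polynomial (L : seq 'End(V)) : {subset L <= G} ->
  exists chi : Spoly V, peval chi q = 1 /\ forall s, s \in L ->
    (~~ (s @: E <= E)%VS -> {in E, forall u, peval chi (s u) = 0}) /\
    ((s @: E <= E)%VS -> s != \1%VF -> peval chi (s q) = 0).
Proof.
elim: L => [|s L IHL] LG.
  by exists 1; split=> //; rewrite /peval meval1.
have sG : s \in G by apply: LG; rewrite mem_head.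
have [|chi [chiq chiL]] := IHL.
  by move=> t tL; apply: LG; rewrite inE tL orbT.
have [l [lq ls]] : exists l : Spoly V, peval l q = 1 /\
    ((~~ (s @: E <= E)%VS -> {in E, forall u, peval l (s u) = 0}) /\
     ((s @: E <= E)%VS -> s != \1%VF -> peval l (s q) = 0)).
  have [sE|sE] := boolP (s @: E <= E)%VS.
    have [->|s1] := eqVneq s \1%VF.
      by exists 1; split=> //; rewrite /peval meval1.
    have sq : s q != q by apply: contra s1 => /eqP/(stab_q sG)/eqP.
    by have [l [lq ls]] := separate_point sq; exists l.
  have qsE : q \notin (s @: E)%VS.
    apply: contra sE => /memv_imgP[u uE qE].
    exact: stabilizer_of_orbit sG uE (esym qE).
  have [l [lq ls]] := separate_subspace qsE; exists l; split=> //.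
  by split=> // _ u uE; apply/ls/memv_img.
exists (chi * l); rewrite pevalM chiq lq mulr1; split=> // t.
rewrite inE => /predU1P[->|/chiL[chi1 chi2]].
  by split=> [sE u uE|sE s1]; rewrite pevalM ?(ls.1 sE u uE) ?(ls.2 sE s1)
    mulr0.
by split=> [sE u uE|sE s1]; rewrite pevalM ?(chi1 sE u uE) ?(chi2 sE s1) mul0r.
Qed.

(** The inner sum is the variable corresponding to [j] when [j] is in [I], and is empty otherwise,
    matching the vanishing of the other basic invariants on [E]. *)
Lemma restrict_comp (P : {mpoly C[n]}) :
  restrict_poly E (P \mPo x) =
  (P \mPo [tuple \sum_(i | f i == j) 'X_i | j < n]) \mPo y.
Proof.
apply: peval_inj => u; rewrite peval_restrict !peval_comp comp_mpoly_meval.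
apply: meval_eq => j; rewrite tnth_mktuple rmorph_sum /=.
have [jI|jI] := boolP (j \in I).
  have jK : f (enum_rank_in jI j) = j by rewrite enum_rankK_in.
  rewrite (big_pred1 (enum_rank_in jI j)) => [|i].
    by rewrite mevalXU tnth_sub_invariants peval_restrict jK.
  by rewrite /= -{1}jK (inj_eq enum_val_inj).
rewrite -peval_restrict restrict_basic_invariant0 // big1 => [|i /eqP fi].
  exact: meval0.
by rewrite -fi enum_valP in jI.
Qed.

(* Given [p], the orbit sums [F j] of [chi * p ^+ j] over [G] (with [p] extended
   to [V]) restrict on [E] to [F 0 * p ^+ j], as [chi] kills the terms outside
   the stabilizer of [E]. *)
Lemma sub_invariants_generate p : Defs.invariant (subquotient E G) p ->
  exists P : {mpoly C[#|I|]}, p = P \mPo y.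
Proof.
have [_ _ [_ _ _ _ xgen] _ _] := data.
have [G1 GM _] := Ggrp; move=> pG.
have [chi [chiq chiG]] : exists chi : Spoly V,
    peval chi q = 1 /\ forall s, s \in G ->
    (~~ (s @: E <= E)%VS -> {in E, forall u, peval chi (s u) = 0}) /\
    ((s @: E <= E)%VS -> s != \1%VF -> peval chi (s q) = 0).
  by apply: separating_polynomial.
pose ext : Spoly V := pullback (linfun (vsproj E)) p.
have extE v : peval ext v = peval p (vsproj E v).
  by rewrite peval_pullback lfunE.
pose F j := \sum_(s <- G) pullback s (chi * ext ^+ j).
have FE j v : peval (F j) v =
    \sum_(s <- G) peval chi (s v) * peval ext (s v) ^+ j.
  rewrite peval_sum; apply: eq_bigr => s _.
  by rewrite peval_pullback pevalM pevalXn.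
have FG j : Defs.invariant G (F j).
  move=> t tG; apply: peval_inj => v; rewrite peval_pullback !FE.
  pose H s := peval chi (s v) * peval ext (s v) ^+ j.
  rewrite -[RHS](sum_group_shift Ggrp H tG); apply: eq_bigr => s _.
  by rewrite /H comp_lfunE.
have Frestrict j : restrict_poly E (F j) = restrict_poly E (F 0%N) * p ^+ j.
  apply: peval_inj => u; rewrite pevalM pevalXn !peval_restrict !FE mulr_suml.
  rewrite !big_seq; apply: eq_bigr => s sG; rewrite expr0 mulr1.
  have [sE|sE] := boolP (s @: E <= E)%VS; last first.
    by rewrite (chiG s sG).1 ?mul0r ?subvsP.
  (* For [s] preserving [E], the restriction of [s] lies in the subquotient, so [p] takes the same
     value at [s u] and [u]. *)
  congr (_ * _ ^+ _); rewrite extE -restrict_endE // vsvalK -peval_pullback.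
  rewrite pG //.
  by apply/subquotientP; exists s.
(* Only the identity contributes at [q]: [chi] vanishes at [s q] for every other [s], since [q] lies
   in [E]. *)
have Fq : peval (F 0%N) q = 1.
  rewrite FE (big_fsetD1 \1%VF) //= id_lfunE chiq expr0 mulr1.
  rewrite big_seq big1 ?addr0 // => s; rewrite !inE => /andP[s1 sG].
  rewrite expr0 mulr1; have [sE|sE] := boolP (s @: E <= E)%VS.
    exact: (chiG s sG).2.
  exact: (chiG s sG).1 sE q eigenspace_q.
have AF j : exists P : {mpoly C[#|I|]}, restrict_poly E (F j) = P \mPo y.
  have [A ->] := xgen _ (FG j); eexists; exact: restrict_comp.
have [theta thetaE] := AF 0%N.
apply: (almost_integral sub_invariants_indep (theta := theta)) => [|j].
  apply: contra_eq_neq Fq => theta0.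
  rewrite -val_q -peval_restrict thetaE theta0 comp_mpoly0 [X in X != _]meval0.
  by rewrite eq_sym oner_neq0.
by have [P PE] := AF j; exists P; rewrite -PE Frestrict thetaE.
Qed.

(** * The admissible triplet, coordinates and good invariants on [E] *)

Local Notation d' := (subtuple I d).
Local Notation g' := (restrict_end E g).

Let n_gt0 : (0 < n)%N.
Proof.
rewrite -(size_tuple d); have := prim_order_gt0 zprim; rewrite /top_degree.
by case: (tval d).
Qed.

Lemma head_mem_indices (i : 'I_n) : i = 0%N :> nat -> i \in I.
Proof. by move=> i0; rewrite inE (tnth_nth 0%N) i0 nth0. Qed.

Lemma top_degree_sub : top_degree d' = top_degree d.
Proof. exact: head_subtuple n_gt0 head_mem_indices. Qed.

Lemma coords_sub : coords b' q' = subtuple I (coords b q).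
Proof.
apply: eq_from_tnth => i; rewrite tnth_subtuple !tnth_mktuple.
by rewrite coord_sub_basis val_q.
Qed.

Lemma eigenspace_stable : (g @: E <= E)%VS.
Proof.
apply/subvP => _ /memv_imgP[v vE ->].
move: vE; rewrite !mem_eigenspace !lfun_powE => /eqP hv.
by rewrite -iterSr iterS hv linearZ.
Qed.

Lemma sub_admissible : admissible_triplet (subquotient E G) d' g' zeta q'.
Proof.
have g'G : g' \in subquotient E G.
  by apply/subquotientP; exists g; rewrite eigenspace_stable.
have gq' : g' q' = zeta *: q'.
  by apply: val_inj; rewrite /= restrict_endE ?eigenspace_stable // val_q gq.
(* An element of the subquotient fixing [q'] is the restriction of some [s] fixing [q]; then [s] is
   the identity, so its restriction is not a reflection. *)
have q'reg : regular_vector (subquotient E G) q'.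
  move=> _ /subquotientP[s [sG sE ->]] [_ s1 _].
  apply: contra s1 => /fixedSpaceP sq; apply/eqP.
  have {}sq : s q = q by rewrite -{1}val_q -restrict_endE // sq val_q.
  rewrite (stab_q sG sq); apply/lfunP => u; apply: val_inj.
  by rewrite /= restrict_endE ?id_lfunE // -(stab_q sG sq).
split=> //; first by rewrite top_degree_sub.
split=> //; exists q' => //.
by rewrite memv_ker add_lfunE opp_lfunE scale_lfunE id_lfunE subr_eq0 gq'.
Qed.

Lemma sub_graded : graded_coordinates d' g' zeta b'.
Proof.
split=> [|i v]; first exact: sub_basisP.
have [g1 [_ gK _]] := group_inv Ggrp gG.
have g'inj : lker g' == 0%VS.
  apply/lker0P => u w /(congr1 vsval);
    rewrite !restrict_endE ?eigenspace_stable //.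
  by move=> /(can_inj gK)/val_inj.
(* Writing [v] as [g' w] turns the claim into [coord_iter] for a single application of [g]. *)
rewrite -{2}(lker0_lfunVK g'inj v); move: (g'^-1%VF v) => w.
rewrite !coord_sub_basis restrict_endE ?eigenspace_stable // tnth_subtuple.
by rewrite (coord_iter _ 1%N) muln1.
Qed.

Lemma sub_basic_invariants : basic_invariants (subquotient E G) d' y.
Proof.
have [_ _ [_ dsort _ _ _] _ _] := data; split.
- exact: esym (vector.size_basis sub_basisP).
- apply: subseq_sorted (subtuple_subseq _ _) dsort.
  by move=> i j l ji il; apply: leq_trans il ji.
- move=> i; rewrite tnth_sub_invariants tnth_subtuple.
  by split; [apply: pullback_homog | apply: restrict_invariant].
- exact: sub_invariants_indep.
- exact: sub_invariants_generate.
Qed.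

Lemma wdeg_ext a : wdeg d (mnm_ext f a) = wdeg d' a.
Proof.
rewrite /wdeg (@big_mnm_ext _ _ f _ _ _ (fun j l => l * tnth d j)%N) //;
  last exact: enum_val_inj.
by apply: eq_bigr => i _; rewrite tnth_subtuple.
Qed.

(** Extension by zero preserves weight and total degree, so each required vanishing is one already
    known for [x] at [q]. *)
Lemma sub_good : good_at d' b' y q'.
Proof.
have [_ _ _ xgood _] := data; move=> i a ai a2.
rewrite tnth_sub_invariants partial_restrict; apply: xgood.
  by rewrite wdeg_ext ai tnth_subtuple.
by rewrite mdeg_ext //; apply: enum_val_inj.
Qed.

Lemma sub_pvf_data : pvf_data (subquotient E G) d' g' zeta q' b' y.
Proof.
split; [exact: sub_admissible | exact: sub_graded | exact: sub_basic_invariants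
  | exact: sub_good | exact: sub_compatible].
Qed.

(** * Restriction of the potential vector field *)

Lemma restrict_pvf_component c :
  restrict_poly E (pvf_component d b x q c) =
  (head 0 (coords b q) / ((tnth d c)%:R - 1)) *:
  \sum_(a : 'X_{1..n < (tnth d c + top_degree d).+1} |
      (wdeg d a == tnth d c + top_degree d)%N && (2 <= mdeg a)%N)
    (partial b a (tnth x c) q / (\prod_i (a i)`!)%N%:R) *:
    \prod_i restrict_poly E (tnth x i) ^+ a i.
Proof.
rewrite /restrict_poly /pullback comp_mpolyZ; congr (_ *: _); rewrite raddf_sum.
apply: eq_bigr => a _; rewrite /= comp_mpolyZ; congr (_ *: _).
by rewrite rmorph_prod; apply: eq_bigr => i _; rewrite rmorphXn.
Qed.

Lemma restrict_monomial0 (a : 'X_{1..n}) j : j \notin I -> a j != 0%N ->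
  \prod_i restrict_poly E (tnth x i) ^+ a i = 0.
Proof.
move=> jI aj; rewrite (bigD1 j) //= restrict_basic_invariant0 //.
by rewrite expr0n (negbTE aj) mul0r.
Qed.

Lemma restrict_pvf0 c : c \notin I ->
  restrict_poly E (tnth (pvf d b x q) c) = 0.
Proof.
move=> cI; rewrite tnth_mktuple restrict_pvf_component big1 ?scaler0 // => a.
move=> /andP[/eqP aN _].
(* If [a] involved only indices in [I], then [delta] would divide its weight, the sum of [tnth d c]
   and the top degree; as it divides the latter, it would divide [tnth d c]. *)
have /existsP[j /andP[jI aj]] : [exists j, (j \notin I) && (a j != 0%N)].
  apply: contraR cI; rewrite negb_exists inE => /forallP aI.
  rewrite -(dvdn_addl _ dvd_delta) -aN /wdeg; apply: dvdn_sum => j _.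
  have := aI j; rewrite negb_and negbK inE => /orP[dj|].
    exact: dvdn_mull.
  by rewrite negbK => /eqP ->; rewrite mul0n dvdn0.
by rewrite (restrict_monomial0 jI aj) scaler0.
Qed.

(** Index 0 lies in [I] because [delta] divides the top degree, so the scalar factors agree.
    Monomials involving an index outside [I] vanish on [E], and [sum_mnm_ext] reindexes the rest;
    the added zero exponents contribute only factors 1 to the factorials and monomials. *)
Lemma restrict_pvf :
  map_tuple (restrict_poly E) (subtuple I (pvf d b x q)) = pvf d' b' y q'.
Proof.
apply: eq_from_tnth => c; rewrite tnth_map tnth_subtuple !tnth_mktuple.
rewrite restrict_pvf_component /pvf_component top_degree_sub tnth_subtuple.
rewrite coords_sub head_subtuple ?n_gt0 //; last exact: head_mem_indices.
congr (_ *: _).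
pose N := (tnth d (f c) + top_degree d)%N.
rewrite (@sum_mnm_ext _ _ f _ N.+1 (fun a => (wdeg d a == N) && (2 <= mdeg a)%N)
  (fun a => (partial b a (tnth x (f c)) q / (\prod_i (a i)`!)%N%:R) *:
    \prod_i restrict_poly E (tnth x i) ^+ a i) enum_val_inj); last first.
  move=> a j _; rewrite codom_enum_val => jI aj.
  by rewrite (restrict_monomial0 jI aj) scaler0.
apply: eq_big => a; first by rewrite wdeg_ext mdeg_ext //; apply: enum_val_inj.
move=> _; rewrite tnth_sub_invariants partial_restrict.
rewrite (@big_mnm_ext _ _ f _ _ _ (fun=> factorial)) //;
  last exact: enum_val_inj.
rewrite (@big_mnm_ext _ _ f _ _ _
  (fun j l => restrict_poly E (tnth x j) ^+ l)) //; last exact: enum_val_inj.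
by congr (_ *: _); apply: eq_bigr => i _; rewrite tnth_sub_invariants.
Qed.

End Subquotient.

(** * Vanishing outside [I], and the potential vector field of the subquotient *)

Theorem theorem3p3 (R : realType) (V : vectType R[i]) (n : nat)
    (G : {fset 'End(V)}) (d : n.-tuple nat)
    (g : 'End(V)) (zeta : R[i]) (q : V) (b : n.-tuple V)
    (x : n.-tuple (Spoly V)) (delta : nat) :
  duality_group G d ->
  pvf_data G d g zeta q b x ->
  (1 < delta)%N -> (delta %| top_degree d)%N ->
  let k := (top_degree d %/ delta)%N in
  let E := passmx.leigenspace (lfun_pow g k) (zeta ^+ k) in
  let I := divisible_indices d delta in
  let P := pvf d b x q in
  (forall c, c \notin I -> restrict_poly E (tnth P c) = 0) /\
  is_potential_vector_field (subquotient E G) (subtuple I d)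
    (map_tuple (restrict_poly E) (subtuple I P)).
Proof.
move=> [[Ggrp _] _ _ _] data _ dvd_delta k E I P; split=> [c cI|].
  exact: restrict_pvf0 Ggrp data dvd_delta c cI.
(* All the data are restrictions to [E] of those of [G], with the same [zeta]. *)
exists (restrict_end E g), zeta, (vsproj E q), (sub_basis d g zeta b delta).
exists (sub_invariants d g zeta x delta); split.
  exact: sub_pvf_data.
exact: restrict_pvf Ggrp data dvd_delta.
Qed.
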